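(* Let $a$ be an integer with $a\ne 0,\pm1$, let $p$ be an odd prime with $p\nmid 3a(a-1)(2-a)(a^3+1)$, and let $\{u_n\}_{n\geq0}$ be the Lucas sequence defined by $$u_0=0,\quad u_1=1,\quad u_{n+1}=(2-a)u_n-(a^2-a+1)u_{n-1}\quad\text{for } n\geq1.$$ (1) If $p\equiv1\pmod 3$, then $$\frac{u_{p-1}}{p}\equiv-\frac{2}{a(a-1)}\sum_{k=1}^{\frac{p-1}{3}}\frac{(-a)^{3k-1}}{3k-1}+\frac{a+1}{3a(a-1)}\left(q_p(a^2-a+1)-2q_p(a+1)\right)\pmod p$$ and $$\sum_{k=1}^{\frac{p-1}{3}}\frac{(-a)^{3k-1}}{3k-1}\equiv\frac{a(a-1)}{a-2}\sum_{k=1}^{\frac{p-1}{2}}\frac{(-3)^{k-1}}{2k-1}\left(\frac{a}{2-a}\right)^{2k-2}+\frac{a(a-1)}{a-2}\left[q_p(a)-q_p(2)+\frac12q_p(3)\right]-\frac{1}{3}(a+1)q_p(a+1)-\frac{a^2-a+1}{3(a-2)}q_p(a^2-a+1)\pmod p.$$ (2) If $p\equiv2\pmod 3$, then $$\frac{u_{p+1}}{p}\equiv\frac{2(a^2-a+1)}{a(a-1)}\sum_{k=1}^{\frac{p+1}{3}}\frac{(-a)^{3k-2}}{3k-2}-\frac{a^3+1}{3a(a-1)}\left(q_p(a^2-a+1)-2q_p(a+1)\right)\pmod p$$ and $$\sum_{k=1}^{\frac{p+1}{3}}\frac{(-a)^{3k-2}}{3k-2}\equiv-\frac{a(a-1)}{a-2}\sum_{k=1}^{\frac{p-1}{2}}\frac{(-3)^{k-1}}{2k-1}\left(\frac{a}{2-a}\right)^{2k-2}+\frac{a(a-1)}{a-2}\left[q_p(a)-q_p(2)+\frac12q_p(3)\right]-\frac{1}{3}(a+1)q_p(a+1)-\frac{a^2-a+1}{3(a-2)}q_p(a^2-a+1)\pmod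 p.$$
   Context: For an odd prime $p$ and an integer $b$ with $p\nmid b$, $q_p(b)=(b^{p-1}-1)/p$ is the Fermat quotient. Congruences modulo $p$ are between rational numbers with denominators prime to $p$: $x\equiv y\pmod p$ means that $x-y=pz$ with $z$ rational whose denominator is prime to $p$. *)

(* Defs.v *)
From mathcomp Require Export all_boot all_order all_algebra.

Set Implicit Arguments.
Unset Strict Implicit.
Unset Printing Implicit Defensive.

Import GRing.Theory Num.Theory.
Local Open Scope ring_scope.

Definition p_integral (p : nat) (x : rat) : bool := coprime p `|denq x|%N.

(* The congruence is a relation between p-integral rationals, so asserting it
   also asserts that both sides are p-integral. *)
Definition rat_eqmod (p : nat) (x y : rat) : Prop :=
  [/\ p_integral p x, p_integral p y
    & exists2 z : rat, p_integral p z & x - y = p%:Q * z].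

(* Meant for p prime and b not divisible by p; the quotient is taken in rat. *)
Definition fermatq (p : nat) (b : int) : rat :=
  (b ^+ (p - 1) - 1)%:Q / p%:Q.

(* Main.v *)
Require Import Defs.
From mathcomp Require Import all_boot all_order all_algebra all_field zify ring.
Import GRing.Theory Num.Theory.
Local Open Scope ring_scope.

(** Let w be a primitive cube root of 1. The characteristic polynomial of u has
    the roots 1 + a w and 1 + a w^2, of product N = a^2 - a + 1, and so u_n is
    ((1 + a w)^n - (1 + a w^2)^n) / (a (w - w^2)). Everything is read off the
    p-th power of 1 + a w.

    Collect the binomial expansion of (1 + a w)^p according to the exponent
    modulo 3: with T_r the sum of ('C(p, k) / p) a^k over 0 < k < p, k = r modulo 3,
<<
      (1 + a w)^p = 1 + a^p w^p + p (T_0 + T_1 w + T_2 w^2)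
>>
    exactly (eisenstein_expp). Since 'C(p, k) / p = (-1)^(k-1) / k modulo p, the
    number - T_r is modulo p the sum of the (-a)^k / k over that residue class
    (class_sum_Fp); the sum in the theorem is the one for r = 2 or for r = 1.
    Writing (1 + a w)^p = X + Y w with integers X, Y, there are four sources of
    exact integer identities:
    - w = 1 in the expansion gives (1 + a)^p in terms of T_0 + T_1 + T_2;
    - the norm gives N^p = X^2 - X Y + Y^2 (eisenstein_norm_expp);
    - Binet's formula expresses u_(p-1) and u_(p+1) linearly in X and Y
      (lucas_eisenstein);
    - expanding (2 - a + a sqrt (-3))^p, which is 2^p (1 + a w)^p, expresses Y by
      (-3)^((p-1)/2) and by the sum over odd exponents, which is the other sum in
      the theorem (eisenstein_coord_odd_sum, odd_sum_Fp).

    Modulo p the identities are trivial; divided by p they become linear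
    relations over 'F_p between the T_r, the Fermat quotients, u_(p-1) / p or
    u_(p+1) / p, and the odd sum (eisenstein_relations). Here (-3)^((p-1)/2) is
    1 or -1 modulo p, with second order term half the Fermat quotient of 3 up to
    sign, because its square is 3^(p-1). Solving the linear system gives both
    congruences (solve_relations1, solve_relations2). *)

(** * Reduction of p-integral rationals to the prime field *)

Lemma Fp_eq0 (p : nat) (n : int) : prime p ->
  (n%:~R == 0 :> 'F_p) = (p%:Z %| n)%Z.
Proof. by move=> p_pr; rewrite -(dvdz_pcharf (pchar_Fp p_pr)). Qed.

Lemma natr_Fp_neq0 (p k : nat) : prime p -> (0 < k < p)%N -> k%:R != 0 :> 'F_p.
Proof.
move=> p_pr /andP[k_gt0 k_lt]; rewrite -(dvdn_pcharf (pchar_Fp p_pr)).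
by apply/negP=> /dvdn_leq; rewrite k_gt0 leqNgt k_lt => /(_ isT).
Qed.

(** The graph of the reduction map from the p-integral rationals to 'F_p. As a
    relation it composes along the syntax of an expression, and producing it
    for an expression also proves that the expression is p-integral. *)
Definition reduces (p : nat) (x : rat) (r : 'F_p) : Prop :=
  exists n d : int,
    [/\ d%:~R != 0 :> 'F_p, x = n%:Q / d%:Q & r = n%:~R / d%:~R].

Lemma Fp_intr_neq0 (p : nat) (d : int) : d%:~R != 0 :> 'F_p -> d%:Q != 0.
Proof. by apply: contraNneq => /eqP; rewrite intr_eq0 => /eqP->. Qed.

Lemma reduces_int p (n : int) : reduces p n%:Q n%:~R.
Proof. by exists n, 1; rewrite oner_neq0 !divr1. Qed.

Lemma reduces_nat p (n : nat) : reduces p n%:R n%:R.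
Proof. exact: (reduces_int p n). Qed.

Lemma reduces1 p : reduces p 1 1.
Proof. exact: (reduces_nat p 1). Qed.

Lemma reducesD p x y r s : reduces p x r -> reduces p y s -> reduces p (x + y) (r + s).
Proof.
move=> [n [d [d0 -> ->]]] [m [e [e0 -> ->]]].
exists (n * e + m * d), (d * e); have [dQ eQ] := (Fp_intr_neq0 _ _ d0, Fp_intr_neq0 _ _ e0).
by split; rewrite ?rmorphD !rmorphM /= ?mulf_neq0 ?addf_div.
Qed.

Lemma reducesM p x y r s : reduces p x r -> reduces p y s -> reduces p (x * y) (r * s).
Proof.
move=> [n [d [d0 -> ->]]] [m [e [e0 -> ->]]].
by exists (n * m), (d * e); split; rewrite !rmorphM /= ?mulf_neq0 ?mulf_div.
Qed.

Lemma reducesN p x r : reduces p x r -> reduces p (- x) (- r).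
Proof.
by move=> [n [d [d0 -> ->]]]; exists (- n), d; split; rewrite ?rmorphN ?mulNr.
Qed.

Lemma reducesV p x r : r != 0 -> reduces p x r -> reduces p x^-1 r^-1.
Proof.
move=> r0 [n [d [d0 -> rE]]]; exists d, n; rewrite rE !invf_div; split=> //.
by apply: contraNneq r0 => n0; rewrite rE n0 mul0r.
Qed.

Lemma reduces_div p x y r s : s != 0 -> reduces p x r -> reduces p y s -> reduces p (x / y) (r / s).
Proof. by move=> s0 xr ys; apply: reducesM => //; apply: reducesV. Qed.

Lemma reducesX p x r n : reduces p x r -> reduces p (x ^+ n) (r ^+ n).
Proof.
move=> xr; elim: n => [|n IHn]; first exact: (reduces_nat p 1).
by rewrite !exprS; apply: reducesM.
Qed.

Lemma reduces_sum p m n (F : nat -> rat) (G : nat -> 'F_p) :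
  (forall k, (m <= k < n)%N -> reduces p (F k) (G k)) ->
  reduces p (\sum_(m <= k < n) F k) (\sum_(m <= k < n) G k).
Proof.
move=> FG; rewrite [X in reduces p X _]big_nat_cond [X in reduces p _ X]big_nat_cond.
elim/big_ind2: _ => [|x r y s|k]; first exact: (reduces_nat p 0).
  exact: reducesD.
by rewrite andbT => /FG.
Qed.

Lemma reduces_integral p x r : prime p -> reduces p x r -> p_integral p x.
Proof.
move=> p_pr [n [d [d0 xE _]]]; rewrite /p_integral prime_coprime //.
apply: contraNN (d0) => p_den; rewrite Fp_eq0 //.
have dQ : d%:Q != 0 by apply: Fp_intr_neq0 d0.
have numE : numq x * d = n * denq x.
  apply: (@intr_inj rat); rewrite !rmorphM /=; apply/eqP.
  rewrite -eqr_div ?intr_eq0 ?denq_neq0 //; last by rewrite -(intr_eq0 rat).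
  by rewrite divq_num_den xE.
have : (p %| `|numq x| * `|d|)%N by rewrite -abszM numE abszM dvdn_mull.
rewrite Euclid_dvdM // => /orP[p_num|//].
have := coprime_num_den x; rewrite /coprime => /eqP num_den.
have := dvdn_gcd p `|numq x| `|denq x|; rewrite num_den p_num p_den dvdn1.
by move/eqP=> p1; rewrite p1 in p_pr.
Qed.

(** Congruences of rationals become equations in the field 'F_p, where linear
    algebra is available. *)
Lemma reduces_eqmod p x y r s : prime p -> reduces p x r -> reduces p y s -> r = s ->
  rat_eqmod p x y.
Proof.
move=> p_pr xr ys rs; have yr : reduces p y r by rewrite rs.
split; [exact: reduces_integral xr | exact: reduces_integral yr | ].
have [n [d [d0 -> nd]]] := xr; have [m [e [e0 -> me]]] := yr.
have [dQ eQ] := (Fp_intr_neq0 _ _ d0, Fp_intr_neq0 _ _ e0).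
have /dvdzP[z zE] : (p%:Z %| n * e - m * d)%Z.
  rewrite -Fp_eq0 // rmorphB !rmorphM /= subr_eq0 -eqr_div //.
  by rewrite -nd -me.
exists (z%:Q / (d * e)%:Q).
  apply: (@reduces_integral _ _ (z%:~R / (d * e)%:~R)) => //; exists z, (d * e).
  by rewrite rmorphM mulf_neq0.
have zQ : (n%:Q * e%:Q - m%:Q * d%:Q) = z%:Q * p%:Q.
  by rewrite -!rmorphM -rmorphB zE.
rewrite rmorphM /= mulrA (mulrC p%:Q) -zQ.
by rewrite -mulNr addf_div // mulNr.
Qed.

(** Reads the reduction of an expression off its syntax; what remains are the
    nonvanishing conditions on the reduced denominators. *)
Ltac reduce_step :=
  match goal with
  | H : ?x = ?q%:~R |- reduces _ ?x _ => rewrite H; exact: reduces_int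
  | |- reduces _ (_ + _) _ => eapply reducesD
  | |- reduces _ (- _) _ => eapply reducesN
  | |- reduces _ (_ / _) _ => eapply reduces_div
  | |- reduces _ (_ * _) _ => eapply reducesM
  | |- reduces _ (_ ^+ _) _ => eapply reducesX
  | |- reduces _ 1 _ => exact: reduces1
  | |- reduces _ (_%:~R) _ => exact: reduces_int
  | |- reduces _ (_%:R) _ => exact: reduces_nat
  | |- reduces _ _ _ => eassumption
  end.

(** * Binomial coefficients divided by p *)

Lemma prime_bin_div (p k : nat) : prime p -> (0 < k < p)%N ->
  'C(p, k) = (p * ('C(p, k) %/ p))%N.
Proof. by move=> p_pr kp; rewrite mulnC divnK // prime_dvd_bin. Qed.

(** Pascal's rule, since 'C(p, k.+1) vanishes modulo p. *)
Lemma bin_predp_Fp (p k : nat) : prime p -> (k < p)%N ->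
  'C(p.-1, k)%:R = (-1) ^+ k :> 'F_p.
Proof.
move=> p_pr; elim: k => [|k IHk] kp; first by rewrite bin0.
have : 'C(p, k.+1)%:R = 0 :> 'F_p.
  by rewrite prime_bin_div // natrM pchar_Fp_0 // mul0r.
have -> : 'C(p, k.+1) = ('C(p.-1, k.+1) + 'C(p.-1, k))%N.
  by rewrite -binS prednK ?prime_gt0.
rewrite natrD IHk ?(ltnW kp) // exprS mulN1r.
by move/eqP; rewrite addr_eq0 => /eqP.
Qed.

(** This turns the binomial coefficients of a p-th power, divided by p, into the
    denominators of the sums to be computed; it comes from
    k 'C(p, k) = p 'C(p - 1, k - 1). *)
Lemma bin_divp_Fp (p k : nat) : prime p -> (0 < k < p)%N ->
  ('C(p, k) %/ p)%:R = (-1) ^+ k.-1 / k%:R :> 'F_p.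
Proof.
move=> p_pr kp; have k0 := natr_Fp_neq0 p k p_pr kp.
apply: (mulIf k0); rewrite divfK // -bin_predp_Fp //; last by lia.
rewrite -natrM; congr (_%:R); apply/eqP; rewrite -(eqn_pmul2l (prime_gt0 p_pr)).
by rewrite mulnA -prime_bin_div // mul_bin_diag mulnC prednK //; lia.
Qed.

(** The terms 0 < k < p of ((1 + a)^p - 1 - a^p) / p with k = r modulo 3, kept
    as exact elements of the ring so that identities can be divided by p. *)
Definition class_sum (R : pzSemiRingType) (p : nat) (a : R) (r : nat) : R :=
  \sum_(1 <= k < p | (k %% 3 == r)%N) ('C(p, k) %/ p)%:R * a ^+ k.

Lemma big_mod3 (V : nmodType) m n (F : nat -> V) :
  \sum_(m <= k < n) F k =
    \sum_(m <= k < n | (k %% 3 == 0)%N) F k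
  + \sum_(m <= k < n | (k %% 3 == 1)%N) F k
  + \sum_(m <= k < n | (k %% 3 == 2)%N) F k.
Proof.
rewrite [X in _ = X + _ + _]big_mkcond [X in _ = _ + X + _]big_mkcond.
rewrite [X in _ = _ + X]big_mkcond -!big_split /=.
apply: eq_bigr => k _; have := ltn_mod k 3.
by case: (k %% 3)%N => [|[|[|]]] //=; rewrite ?addr0 ?add0r.
Qed.

(** In the binomial expansion of (1 + a z)^p the powers of z only depend on the
    exponent modulo 3. Used for z = 1 and for z a primitive cube root of 1. *)
Lemma exprD1_root3 (R : comPzRingType) (p : nat) (a z : R) :
  prime p -> z ^+ 3 = 1 ->
  (1 + a * z) ^+ p = 1 + a ^+ p * z ^+ p
    + p%:R * (class_sum R p a 0 + class_sum R p a 1 * z + class_sum R p a 2 * z ^+ 2).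
Proof.
move=> p_pr z3; have p_gt0 := prime_gt0 p_pr.
rewrite exprDn -(big_mkord xpredT (fun i => 1 ^+ (p - i) * (a * z) ^+ i *+ 'C(p, i))).
rewrite big_nat_recr // big_ltn //= subnn subn0 expr0 !expr1n !mul1r bin0 binn !mulr1n.
rewrite [in X in _ + X = _]exprMn.
rewrite -!addrA; congr (_ + _); rewrite addrC; congr (_ + _).
rewrite (eq_big_nat _ _ (F2 := fun k => p%:R * (('C(p, k) %/ p)%:R * a ^+ k * z ^+ k))).
  rewrite -mulr_sumr big_mod3 /class_sum !mulr_suml -!addrA.
  congr (_ * (_ + (_ + _))); apply: eq_bigr => k /eqP k3;
    by rewrite -(expr_mod k z3) k3 ?expr0 ?mulr1.
move=> k kp; rewrite expr1n mul1r -mulr_natl {1}(prime_bin_div _ _ p_pr kp) natrM exprMn.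
by rewrite !mulrA.
Qed.

(** * Powers of Eisenstein integers, exactly *)

(** An embedding of the Eisenstein integers in a field of characteristic 0. *)
Lemma cube_root_exists : exists w : algC, w ^+ 2 = - w - 1.
Proof.
exists ((-1 + sqrtC (-3)) / 2).
have s2 : sqrtC (-3 : algC) ^+ 2 = -3 := sqrtCK _.
by field: s2.
Qed.

Lemma cube_root_conj (R : comPzRingType) (w : R) :
  w ^+ 2 = - w - 1 -> (- 1 - w) ^+ 2 = - (- 1 - w) - 1.
Proof. by move=> w2; ring: w2. Qed.

Lemma cube_root_expr3 (R : comPzRingType) (w : R) : w ^+ 2 = - w - 1 -> w ^+ 3 = 1.
Proof. by move=> w2; ring: w2. Qed.

(** 2 w + 1 is a square root of -3. *)
Lemma sqrt_disc_neq0 (w : algC) : w ^+ 2 = - w - 1 -> 2 * w + 1 != 0.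
Proof.
move=> w2; have s2 : (2 * w + 1) ^+ 2 = - 3 by ring: w2.
by apply/eqP=> s0; move/eqP: s2; rewrite s0 expr0n /= eq_sym oppr_eq0 pnatr_eq0.
Qed.

Lemma intr_class_sum (a : int) (R : comPzRingType) p r :
  (class_sum int p a r)%:~R = class_sum R p a%:~R r.
Proof.
rewrite /class_sum rmorph_sum; apply: eq_bigr => k _.
by rewrite rmorphM rmorphXn rmorph_nat.
Qed.

(** The expansion of (1 + a w)^p in the basis 1, w; the coordinates are integers
    up to the power of w, which is w or w^2 according to p modulo 3. *)
Lemma eisenstein_expp (a : int) (p : nat) (w : algC) :
  prime p -> w ^+ 2 = - w - 1 ->
  (1 + a%:~R * w) ^+ p = 1 + a%:~R ^+ p * w ^+ (p %% 3)
   + p%:R * ((class_sum int p a 0 - class_sum int p a 2)%:~R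
             + (class_sum int p a 1 - class_sum int p a 2)%:~R * w).
Proof.
move=> p_pr w2; have w3 := cube_root_expr3 _ _ w2.
rewrite exprD1_root3 // -!intr_class_sum !rmorphB /= (expr_mod p w3).
by ring: w2.
Qed.

(** For p = 1 modulo 3: the coordinates, split into their values 1 and a modulo p
    and multiples of p, a^p being written by the Fermat quotient of a. *)
Lemma eisenstein_expp1 (a qa : int) (p : nat) (w : algC) :
  prime p -> (p %% 3 = 1)%N -> a ^+ p = a * (1 + p%:R * qa) -> w ^+ 2 = - w - 1 ->
  (1 + a%:~R * w) ^+ p
  = (1 + p%:R * (class_sum int p a 0 - class_sum int p a 2))%:~R
  + (1 * a + p%:R * (a * qa + class_sum int p a 1 - class_sum int p a 2))%:~R * w.
Proof.
move=> p_pr p3 ap w2; rewrite eisenstein_expp // p3 expr1 -rmorphXn ap.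
move: (class_sum int p a 0) (class_sum int p a 1) (class_sum int p a 2) => T0 T1 T2.
rewrite !(rmorphD, rmorphM, rmorphB, rmorph_nat, rmorphN) /=.
ring.
Qed.

(** For p = 2 modulo 3, where w^p = w^2 = - w - 1 moves a^p into both coordinates,
    which are 1 - a and - a modulo p. *)
Lemma eisenstein_expp2 (a qa : int) (p : nat) (w : algC) :
  prime p -> (p %% 3 = 2)%N -> a ^+ p = a * (1 + p%:R * qa) -> w ^+ 2 = - w - 1 ->
  (1 + a%:~R * w) ^+ p
  = (1 - a + p%:R * (class_sum int p a 0 - class_sum int p a 2 - a * qa))%:~R
  + ((- 1) * a + p%:R * (class_sum int p a 1 - class_sum int p a 2 - a * qa))%:~R * w.
Proof.
move=> p_pr p3 ap w2; rewrite eisenstein_expp // p3 w2 -rmorphXn ap.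
move: (class_sum int p a 0) (class_sum int p a 1) (class_sum int p a 2) => T0 T1 T2.
rewrite !(rmorphD, rmorphM, rmorphB, rmorph_nat, rmorphN) /=.
ring.
Qed.

(** Only the odd powers of y survive in the difference. *)
Lemma exprD_subB_odd (R : comPzRingType) (x y : R) h :
  (x + y) ^+ h.*2.+1 - (x - y) ^+ h.*2.+1
    = 2 * \sum_(0 <= j < h.+1) 'C(h.*2.+1, j.*2.+1)%:R * x ^+ (h - j).*2 * y ^+ j.*2.+1.
Proof.
have big_pairs (F : nat -> R) n :
    \sum_(0 <= i < n.*2) F i = \sum_(0 <= j < n) (F j.*2 + F j.*2.+1).
  elim: n => [|n IHn]; first by rewrite !big_geq.
  by rewrite doubleS !big_nat_recr //= IHn addrA.
rewrite !exprDn -!(big_mkord xpredT (fun i => x ^+ (_ - i) * _ ^+ i *+ 'C(_, i))).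
rewrite -sumrB -[h.*2.+2]/(h.+1.*2) big_pairs mulr_sumr; apply: eq_big_nat => j jh.
have -> : (h.*2.+1 - j.*2.+1 = (h - j).*2)%N by lia.
have -> : (- y) ^+ j.*2 = y ^+ j.*2 by rewrite -mul2n !exprM sqrrN.
have -> : (- y) ^+ j.*2.+1 = - y ^+ j.*2.+1 by rewrite !exprS -mul2n !exprM sqrrN mulNr.
rewrite subrr add0r mulrN mulNrn opprK -mulr2n -[LHS]mulr_natl.
by rewrite -[X in 2 * X = _]mulr_natl !mulrA.
Qed.

(** With s^2 = -3 and p odd, 2 p a s times this integer collects the terms of
    (2 - a + a s)^p - (2 - a - a s)^p other than the last one. *)
Definition odd_sum (p : nat) (a : int) : int :=
  \sum_(1 <= k < ((p - 1) %/ 2).+1) ('C(p, 2 * k - 1) %/ p)%:R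
     * ((2 - a) ^+ (p + 1 - 2 * k) * (a ^+ (2 * k - 2) * (- 3) ^+ (k - 1))).

(** Since 2 (1 + a w) = 2 - a + a s for s = 2 w + 1 = sqrt (-3), the coordinate Y
    is also given by the expansion of the p-th power of 2 - a + a s: compare the
    coefficients of s, that is, subtract the conjugate. *)
Lemma eisenstein_coord_odd_sum (p : nat) (a X Y : int) :
  prime p -> odd p ->
  (forall w : algC, w ^+ 2 = - w - 1 -> (1 + a%:~R * w) ^+ p = X%:~R + Y%:~R * w) ->
  2 ^+ (p - 1) * Y = a ^+ p * (- 3) ^+ (p./2) + p%:R * a * odd_sum p a.
Proof.
move=> p_pr p_odd XY; have [w w2] := cube_root_exists.
have s2 : (2 * w + 1) ^+ 2 = - 3 by ring: w2.
have s0 := sqrt_disc_neq0 _ w2.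
have ph : p = (p./2).*2.+1 by rewrite -[LHS]odd_double_half p_odd.
apply: (@intr_inj algC); apply: (mulfI (_ : 2 * (2 * w + 1) != 0)).
  by rewrite mulf_neq0 ?pnatr_eq0.
have -> : 2 * (2 * w + 1) * (2 ^+ (p - 1) * Y)%:~R
   = (2 - a%:~R + a%:~R * (2 * w + 1)) ^+ p - (2 - a%:~R - a%:~R * (2 * w + 1)) ^+ p.
  have -> : 2 - a%:~R + a%:~R * (2 * w + 1) = 2 * (1 + a%:~R * w) by ring.
  have -> : 2 - a%:~R - a%:~R * (2 * w + 1) = 2 * (1 + a%:~R * (- 1 - w)) by ring.
  rewrite !exprMn (XY _ w2) (XY _ (cube_root_conj _ _ w2)) subn1.
  by rewrite -(prednK (prime_gt0 p_pr)) exprS /= rmorphM rmorphXn /=; ring.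
set s := 2 * w + 1 in s2 s0 *.
have s_odd j : s ^+ j.*2.+1 = s * (- 3) ^+ j by rewrite exprS -mul2n exprM s2.
have sp : s ^+ p = s * (- 3) ^+ p./2 by rewrite [in LHS]ph s_odd.
rewrite {1 2}ph exprD_subB_odd -ph -[RHS]mulrA; congr (_ * _).
rewrite big_nat_recr //= -ph binn subnn mul1r expr0 mul1r exprMn sp.
rewrite [LHS]addrC [X in _ = _ * X]rmorphD [RHS]mulrDr; congr (_ + _).
  by rewrite rmorphM !rmorphXn rmorphN /= mulrCA.
rewrite rmorphM rmorph_sum /= !mulr_sumr big_add1 /=.
have -> : ((p - 1) %/ 2 = p./2)%N by lia.
apply: eq_big_nat => j jh.
have -> : (2 * j.+1 - 1 = j.*2.+1)%N by lia.
have -> : (2 * j.+1 - 2 = j.*2)%N by lia.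
have -> : (p + 1 - 2 * j.+1 = (p./2 - j).*2)%N by lia.
have -> : (j.+1 - 1 = j)%N by lia.
rewrite [in LHS]prime_bin_div ?natrM; [|done|by lia].
rewrite exprMn s_odd.
rewrite !(rmorphM, rmorphXn, rmorphB, rmorphN, rmorph_nat) /= exprS; ring.
Qed.

Lemma lucas_binet (R : comPzRingType) (x y : R) (P Q : int) (u : nat -> int) :
  x + y = P%:~R -> x * y = Q%:~R -> u 0%N = 0 -> u 1%N = 1 ->
  (forall n, (1 <= n)%N -> u (n + 1)%N = P * u n - Q * u (n - 1)%N) ->
  forall n, (u n)%:~R * (x - y) = x ^+ n - y ^+ n.
Proof.
move=> xyP xyQ u0 u1 u_rec n.
suff [] : (u n)%:~R * (x - y) = x ^+ n - y ^+ n
       /\ (u n.+1)%:~R * (x - y) = x ^+ n.+1 - y ^+ n.+1 by [].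
elim: n => [|n [IHn IHSn]]; first by rewrite u0 u1 mul0r mul1r subrr.
split=> //; have := u_rec n.+1 isT; rewrite addn1 subn1 /= => ->.
rewrite rmorphB !rmorphM /= -xyP -xyQ mulrBl -!mulrA IHn IHSn !exprS; ring.
Qed.

(** Multiply by the conjugate: 1 + a w has norm a^2 - a + 1. *)
Lemma eisenstein_norm_expp (a X Y : int) (p : nat) :
  (forall w : algC, w ^+ 2 = - w - 1 -> (1 + a%:~R * w) ^+ p = X%:~R + Y%:~R * w) ->
  (a ^+ 2 - a + 1) ^+ p = X ^+ 2 - X * Y + Y ^+ 2.
Proof.
move=> XY; have [w w2] := cube_root_exists; have w2' := cube_root_conj _ _ w2.
apply: (@intr_inj algC).
have -> : ((a ^+ 2 - a + 1) ^+ p)%:~R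
    = (1 + a%:~R * w) ^+ p * (1 + a%:~R * (- 1 - w)) ^+ p.
  by rewrite -exprMn rmorphXn /=; congr (_ ^+ p); ring: w2.
by rewrite !XY //; ring: w2.
Qed.

(** The roots of the characteristic polynomial of u are 1 + a w and its conjugate,
    which differ by a (2 w + 1). Their (p - 1)-st powers are obtained from the
    p-th ones by multiplying by the conjugate and dividing by the norm, their
    (p + 1)-st powers by one more multiplication. *)
Lemma lucas_eisenstein (a X Y : int) (p : nat) (u : nat -> int) :
  a != 0 -> (0 < p)%N ->
  u 0%N = 0 -> u 1%N = 1 ->
  (forall n, (1 <= n)%N ->
     u (n + 1)%N = (2 - a) * u n - (a ^+ 2 - a + 1) * u (n - 1)%N) ->
  (forall w : algC, w ^+ 2 = - w - 1 -> (1 + a%:~R * w) ^+ p = X%:~R + Y%:~R * w) ->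
  (a ^+ 2 - a + 1) * a * u (p - 1)%N = Y - a * X
  /\ a * u (p + 1)%N = Y + a * X - a * Y.
Proof.
move=> a0 p_gt0 u0 u1 u_rec XY; have [w w2] := cube_root_exists.
have w2' := cube_root_conj _ _ w2; have s0 := sqrt_disc_neq0 _ w2.
have binet n : a%:~R * (u n)%:~R * (2 * w + 1)
    = (1 + a%:~R * w) ^+ n - (1 + a%:~R * (- 1 - w)) ^+ n.
  rewrite -(lucas_binet _ _ _ (2 - a) (a ^+ 2 - a + 1) u _ _ u0 u1 u_rec).
  - by ring.
  - by ring.
  - by ring: w2.
split; apply: (@intr_inj algC); apply: (mulIf s0).
  have pow (z : algC) : z ^+ 2 = - z - 1 ->
      (1 + a%:~R * z) * (1 + a%:~R * z) ^+ (p - 1) = X%:~R + Y%:~R * z.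
    by move=> z2; rewrite -XY // -exprS subn1 prednK.
  rewrite 2!intrM -!mulrA [_ * (_ * (2 * w + 1))]mulrA binet.
  have -> : (a ^+ 2 - a + 1)%:~R = (1 + a%:~R * w) * (1 + a%:~R * (- 1 - w)).
    by ring: w2.
  rewrite mulrBr mulrAC pow // -mulrA pow //; ring: w2.
rewrite rmorphM binet addn1 !exprS !XY //; ring: w2.
Qed.

(** * Division by p *)

(** Derives an equation from another one when both have the same difference of
    sides; that equality of differences is a ring identity. *)
Lemma eq_from_sub (V : zmodType) (x y z t : V) : z = t -> x - y = z - t -> x = y.
Proof. by move=> -> /eqP; rewrite subrr subr_eq0 => /eqP. Qed.

Lemma intr_Fp_p (p : nat) : prime p -> (p%:R : int)%:~R = 0 :> 'F_p.
Proof. by move=> p_pr; rewrite rmorph_nat pchar_Fp_0. Qed.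

(** How an exact integer identity is divided by p and then reduced: the term
    p z disappears. *)
Lemma int_Fp_divp (p : nat) (m n z : int) : prime p ->
  p%:R * m = p%:R * (n + p%:R * z) -> m%:~R = n%:~R :> 'F_p.
Proof.
move=> p_pr /(mulfI _) ->; last by rewrite pnatr_eq0 -lt0n prime_gt0.
by rewrite rmorphD rmorphM /= intr_Fp_p // mul0r addr0.
Qed.

Lemma fermat_quotient (p : nat) (b : int) : prime p -> b%:~R != 0 :> 'F_p ->
  exists2 q : int, b ^+ (p - 1) = 1 + p%:R * q & fermatq p b = q%:Q.
Proof.
move=> p_pr b0; have /dvdzP[q qE] : (p%:Z %| b ^+ (p - 1) - 1)%Z.
  rewrite -Fp_eq0 // rmorphB rmorphXn /= subr_eq0; apply/eqP.
  apply: (mulfI b0); rewrite mulr1 -exprS subn1 prednK ?prime_gt0 //.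
  by rewrite -[X in _ ^+ X](card_Fp p_pr) expf_card.
exists q; first by rewrite mulrC natz -qE addrC subrK.
by rewrite /fermatq qE rmorphM /= mulfK // pnatr_eq0 -lt0n prime_gt0.
Qed.

(** The four identities for the coordinates, divided by p. The first comes from
    (1 + a)^p, the second from the norm, the third from the two expansions of
    the coordinate of w, the fourth from squaring (-3)^((p-1)/2). The sign e is 1
    if p is 1 modulo 3 and -1 otherwise; that (-3)^((p-1)/2) = e modulo p is
    itself the third identity before division by p. The integer E is the
    quotient ((-3)^((p-1)/2) - e) / p. The terms of order 0 in the
    coordinates are x and e a; their norm has to be a^2 - a + 1 for the terms of
    order 0 in the second identity to cancel. *)
Lemma eisenstein_relations (p : nat) (a e x X Y qa qa1 qN q2 q3 T : int) :
  prime p -> odd p -> a%:~R != 0 :> 'F_p -> e ^+ 2 = 1 ->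
  x ^+ 2 - x * (e * a) + (e * a) ^+ 2 = a ^+ 2 - a + 1 ->
  (forall w : algC, w ^+ 2 = - w - 1 ->
     (1 + a%:~R * w) ^+ p = (x + p%:R * X)%:~R + (e * a + p%:R * Y)%:~R * w) ->
  (1 + a) ^+ p = 1 + a ^+ p + p%:R * T ->
  a ^+ (p - 1) = 1 + p%:R * qa ->
  (a + 1) ^+ (p - 1) = 1 + p%:R * qa1 ->
  (a ^+ 2 - a + 1) ^+ (p - 1) = 1 + p%:R * qN ->
  2 ^+ (p - 1) = 1 + p%:R * q2 ->
  3 ^+ (p - 1) = 1 + p%:R * q3 ->
  exists E : int,
  [/\ ((a + 1) * qa1)%:~R = (a * qa + T)%:~R :> 'F_p,
      ((a ^+ 2 - a + 1) * qN)%:~R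
        = (2 * x * X - x * Y - e * a * X + 2 * e * a * Y)%:~R :> 'F_p,
      (e * a * q2 + Y)%:~R = (e * a * qa + a * E + a * odd_sum p a)%:~R :> 'F_p
    & (2 * e * E)%:~R = q3%:~R :> 'F_p].
Proof.
move=> p_pr p_odd a0 e2 xe XY ET Ea Ea1 EN E2 E3.
have expp (b q : int) : b ^+ (p - 1) = 1 + p%:R * q -> b ^+ p = b * (1 + p%:R * q).
  by move=> <-; rewrite -exprS subn1 prednK ?prime_gt0.
have D_eq := eisenstein_coord_odd_sum _ _ _ _ p_pr p_odd XY.
have D2 : ((-3) ^+ p./2) ^+ 2 = 1 + p%:R * q3 :> int.
  have p1 : (p - 1 = 2 * p./2)%N by move: p_odd; clear; lia.
  by rewrite -E3 p1 -exprM mulnC !exprM sqrrN.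
have /dvdzP[E EE] : (p%:Z %| (-3) ^+ p./2 - e)%Z.
  rewrite -Fp_eq0 // rmorphB subr_eq0 eq_sym; apply/eqP/(mulfI a0).
  have /(congr1 (fun n : int => n%:~R : 'F_p)) := D_eq.
  rewrite E2 (expp _ _ Ea) !(rmorphD, rmorphM) /= intr_Fp_p // rmorph1.
  rewrite !(mul0r, addr0, mul1r, mulr1) => <-; exact: mulrC.
move: D_eq D2; rewrite E2 (expp _ _ Ea) => D_eq D2.
have {}EE : (-3) ^+ p./2 = e + p%:R * E by rewrite mulrC natz -EE addrC subrK.
rewrite EE in D_eq D2.
have EN' := eisenstein_norm_expp _ _ _ _ XY; rewrite (expp _ _ EN) in EN'.
rewrite (expp _ _ Ea) addrC (expp _ _ Ea1) in ET.
exists E; split.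
- by apply: (@int_Fp_divp _ _ _ 0) => //; apply: (eq_from_sub _ _ _ _ _ ET); ring.
- apply: (@int_Fp_divp _ _ _ (X ^+ 2 - X * Y + Y ^+ 2)) => //.
  apply: (eq_from_sub _ _ _ _ _ (congr2 +%R EN' xe)).
  by ring.
- apply: (@int_Fp_divp _ _ _ (a * qa * E - q2 * Y)) => //.
  by apply: (eq_from_sub _ _ _ _ _ D_eq); ring.
- apply: (@int_Fp_divp _ _ _ (- E ^+ 2)) => //.
  apply: (eq_from_sub _ _ _ _ _ (congr2 (fun m n : int => m - n) D2 e2)).
  by ring.
Qed.

(** * The sums modulo p *)

Lemma big_mod3_eq2 (V : nmodType) (F : nat -> V) n m : n = (3 * m).+1 ->
  \sum_(1 <= k < n | (k %% 3 == 2)%N) F k = \sum_(1 <= k < m.+1) F (3 * k - 1)%N.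
Proof.
move=> ->; elim: m => [|m IHm]; first by rewrite muln0 !big_geq.
have -> : (3 * m.+1 = (3 * m).+3)%N by lia.
rewrite [RHS]big_nat_recr //= -IHm big_mkcond [in RHS]big_mkcond.
do 3!rewrite big_nat_recr //=.
have -> : ((3 * m).+1 %% 3 = 1)%N by rewrite -addn1 mulnC modnMDl.
have -> : ((3 * m).+2 %% 3 = 2)%N by rewrite -addn2 mulnC modnMDl.
have -> : ((3 * m).+3 %% 3 = 0)%N by rewrite -addn3 mulnC modnMDl.
by rewrite /= !addr0; congr (_ + F _); lia.
Qed.

Lemma big_mod3_eq1 (V : nmodType) (F : nat -> V) n m : n = (3 * m).+2 ->
  \sum_(1 <= k < n | (k %% 3 == 1)%N) F k = \sum_(1 <= k < m.+2) F (3 * k - 2)%N.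
Proof.
move=> ->; elim: m => [|m IHm].
  by rewrite muln0 big_mkcond !big_nat1.
have -> : (3 * m.+1 = (3 * m).+3)%N by lia.
rewrite [RHS]big_nat_recr //= -IHm big_mkcond [in RHS]big_mkcond.
do 3!rewrite big_nat_recr //=.
have -> : ((3 * m).+4 %% 3 = 1)%N by rewrite -addn4 mulnC modnMDl.
have -> : ((3 * m).+2 %% 3 = 2)%N by rewrite -addn2 mulnC modnMDl.
have -> : ((3 * m).+3 %% 3 = 0)%N by rewrite -addn3 mulnC modnMDl.
by rewrite /= !addr0; congr (_ + F _); lia.
Qed.

(** Up to sign, the class sums lift the sums of (-a)^k / k over a residue class. *)
Lemma class_sum_Fp (p : nat) (a : int) r : prime p ->
  (class_sum int p a r)%:~R
  = - \sum_(1 <= k < p | (k %% 3 == r)%N) (- a%:~R) ^+ k / k%:R :> 'F_p.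
Proof.
move=> p_pr; rewrite intr_class_sum /class_sum -sumrN.
rewrite big_nat_cond [RHS]big_nat_cond; apply: eq_bigr => k /andP[kp _].
rewrite bin_divp_Fp // [(- _) ^+ k]exprNn; case: k kp => // k _.
by rewrite [(-1) ^+ _.+1]exprS mulN1r !mulNr opprK mulrAC.
Qed.

(** Fermat's little theorem turns (2 - a)^(p + 1 - 2 k) into (2 - a)^(2 - 2 k). *)
Lemma odd_sum_Fp (p : nat) (a : int) : prime p -> odd p -> (2 - a)%:~R != 0 :> 'F_p ->
  (odd_sum p a)%:~R
  = \sum_(1 <= k < ((p - 1) %/ 2).+1)
      (- 3) ^+ (k - 1) / (2 * k - 1)%:R * (a%:~R / (2 - a%:~R)) ^+ (2 * k - 2) :> 'F_p.
Proof.
move=> p_pr p_odd a2; rewrite /odd_sum rmorph_sum; apply: eq_big_nat => k kp.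
have {}a2 : 2 - a%:~R != 0 :> 'F_p by move: a2; rewrite rmorphB.
rewrite !(rmorphM, rmorphXn, rmorph_nat) /= bin_divp_Fp //; last by lia.
rewrite rmorphB rmorphN /= !rmorph_nat expr_div_n.
have -> : (-1) ^+ (2 * k - 1).-1 = 1 :> 'F_p.
  by rewrite -signr_odd; have -> : odd (2 * k - 1).-1 = false by lia.
have -> : (2 - a%:~R) ^+ (p + 1 - 2 * k) = ((2 - a%:~R) ^+ (2 * k - 2))^-1 :> 'F_p.
  apply: (mulfI (expf_neq0 (2 * k - 2) a2)); rewrite divff ?expf_neq0 // -exprD.
  apply: (mulfI a2); rewrite mulr1 -exprS -[RHS]expf_card (card_Fp p_pr).
  congr (_ ^+ _); lia.
rewrite mul1r; move: ((_ ^+ _)^-1) (_%:R^-1) => i j.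
by rewrite !mulrA mulrC -!mulrA [i * _]mulrC !mulrA.
Qed.

Lemma reduces_class_sum2 (p : nat) (a : int) : prime p -> (p = 1 %[mod 3])%N ->
  reduces p (\sum_(1 <= k < ((p - 1) %/ 3).+1) (- a%:Q) ^+ (3 * k - 1) / (3 * k - 1)%N%:Q)
    (- (class_sum int p a 2)%:~R).
Proof.
move=> p_pr p3; set m := ((p - 1) %/ 3)%N.
have pE : p = (3 * m).+1 by rewrite /m; move: p3 (prime_gt0 p_pr); clear; lia.
rewrite class_sum_Fp // opprK (big_mod3_eq2 _ _ _ _ pE); apply: reduces_sum => k km.
have k0 : (3 * k - 1)%:R != 0 :> 'F_p.
  by apply: natr_Fp_neq0 => //; move: km pE; clear; lia.
by repeat reduce_step.
Qed.

Lemma reduces_class_sum1 (p : nat) (a : int) : prime p -> (p = 2 %[mod 3])%N ->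
  reduces p (\sum_(1 <= k < ((p + 1) %/ 3).+1) (- a%:Q) ^+ (3 * k - 2) / (3 * k - 2)%N%:Q)
    (- (class_sum int p a 1)%:~R).
Proof.
move=> p_pr p3; set m := ((p - 2) %/ 3)%N.
have pE : p = (3 * m).+2 by rewrite /m; move: p3 (prime_gt1 p_pr); clear; lia.
have -> : ((p + 1) %/ 3 = m.+1)%N by move: pE; clear; lia.
rewrite class_sum_Fp // opprK (big_mod3_eq1 _ _ _ _ pE); apply: reduces_sum => k km.
have k0 : (3 * k - 2)%:R != 0 :> 'F_p.
  by apply: natr_Fp_neq0 => //; move: km pE; clear; lia.
by repeat reduce_step.
Qed.

Lemma reduces_odd_sum (p : nat) (a : int) : prime p -> odd p -> (2 - a)%:~R != 0 :> 'F_p ->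
  reduces p (\sum_(1 <= k < ((p - 1) %/ 2).+1)
           (- 3) ^+ (k - 1) / (2 * k - 1)%N%:Q * (a%:Q / (2 - a%:Q)) ^+ (2 * k - 2))
    (odd_sum p a)%:~R.
Proof.
move=> p_pr p_odd a2; rewrite odd_sum_Fp //; apply: reduces_sum => k km.
have {}a2 : 2 - a%:~R != 0 :> 'F_p by move: a2; rewrite rmorphB.
have k0 : (2 * k - 1)%:R != 0 :> 'F_p.
  by apply: natr_Fp_neq0 => //; move: km; clear; lia.
by repeat reduce_step.
Qed.

(** * Elimination *)

(** The linear relations for p = 1 modulo 3. They determine w, qa1, qN and V as
    rational functions of a, the T's and the other quotients; after substitution
    the claims are identities of rational functions. *)
Lemma solve_relations1 (F : fieldType) (a T0 T1 T2 qa qa1 qN q2 q3 w E V : F) :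
  a != 0 -> a - 1 != 0 -> a - 2 != 0 -> a + 1 != 0 -> a ^+ 2 - a + 1 != 0 ->
  3 != 0 :> F -> 2 != 0 :> F ->
  (a + 1) * qa1 = a * qa + (T0 + T1 + T2) ->
  (a ^+ 2 - a + 1) * qN = 2 * (T0 - T2) - (a * qa + T1 - T2) - a * (T0 - T2)
     + 2 * a * (a * qa + T1 - T2) ->
  a * q2 + (a * qa + T1 - T2) = a * qa + a * E + a * V ->
  2 * E = q3 ->
  (a ^+ 2 - a + 1) * a * w = (a * qa + T1 - T2) - a * (T0 - T2) ->
  w = - (2 / (a * (a - 1))) * (- T2) + (a + 1) / (3 * a * (a - 1)) * (qN - 2 * qa1)
  /\ - T2 = a * (a - 1) / (a - 2) * V
       + a * (a - 1) / (a - 2) * (qa - q2 + 1 / 2 * q3)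
       - 1 / 3 * (a + 1) * qa1 - (a ^+ 2 - a + 1) / (3 * (a - 2)) * qN.
Proof.
move=> a0 a1 a2 a1' N0 n3 n2 R1 R2 R4 R5 R3.
have -> : w = ((a * qa + T1 - T2) - a * (T0 - T2)) / ((a ^+ 2 - a + 1) * a).
  by rewrite -R3 mulrAC divff ?mul1r ?mulf_neq0.
have -> : qa1 = (a * qa + (T0 + T1 + T2)) / (a + 1) by rewrite -R1 mulrAC divff ?mul1r.
have -> : V = q2 + (T1 - T2) / a - E.
  apply: (mulfI a0); apply: (eq_from_sub _ _ _ _ _ (esym R4)); field; exact: a0.
have -> : qN = (2 * (T0 - T2) - (a * qa + T1 - T2) - a * (T0 - T2)
     + 2 * a * (a * qa + T1 - T2)) / (a ^+ 2 - a + 1).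
  by rewrite -R2 mulrAC divff ?mul1r.
rewrite -R5; split; field.
  by rewrite ?a0 ?a1 ?a1' ?N0 ?n3.
by rewrite ?a0 ?a1 ?a2 ?a1' ?N0 ?n3 ?n2.
Qed.

(** The relations for p = 2 modulo 3, solved for the same quantities. The norm
    a^2 - a + 1 is not a factor in the relation for w, because u_(p+1), unlike
    u_(p-1), is reached from the p-th powers without dividing by it. *)
Lemma solve_relations2 (F : fieldType) (a T0 T1 T2 qa qa1 qN q2 q3 w E V : F) :
  a != 0 -> a - 1 != 0 -> a - 2 != 0 -> a + 1 != 0 -> a ^+ 2 - a + 1 != 0 ->
  3 != 0 :> F -> 2 != 0 :> F ->
  (a + 1) * qa1 = a * qa + (T0 + T1 + T2) ->
  (a ^+ 2 - a + 1) * qN = 2 * (1 - a) * (T0 - T2 - a * qa)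
     - (1 - a) * (T1 - T2 - a * qa) + a * (T0 - T2 - a * qa)
     - 2 * a * (T1 - T2 - a * qa) ->
  - a * q2 + (T1 - T2 - a * qa) = - a * qa + a * E + a * V ->
  - 2 * E = q3 ->
  a * w = (T1 - T2 - a * qa) + a * (T0 - T2 - a * qa) - a * (T1 - T2 - a * qa) ->
  w = 2 * (a ^+ 2 - a + 1) / (a * (a - 1)) * (- T1)
      - (a ^+ 3 + 1) / (3 * a * (a - 1)) * (qN - 2 * qa1)
  /\ - T1 = - (a * (a - 1) / (a - 2)) * V
       + a * (a - 1) / (a - 2) * (qa - q2 + 1 / 2 * q3)
       - 1 / 3 * (a + 1) * qa1 - (a ^+ 2 - a + 1) / (3 * (a - 2)) * qN.
Proof.
move=> a0 a1 a2 a1' N0 n3 n2 R1 R2 R4 R5 R3.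
have -> : w = ((T1 - T2 - a * qa) + a * (T0 - T2 - a * qa) - a * (T1 - T2 - a * qa)) / a.
  by rewrite -R3 mulrAC divff ?mul1r.
have -> : qa1 = (a * qa + (T0 + T1 + T2)) / (a + 1) by rewrite -R1 mulrAC divff ?mul1r.
have -> : V = - q2 + (T1 - T2) / a - E.
  apply: (mulfI a0); apply: (eq_from_sub _ _ _ _ _ (esym R4)); field; exact: a0.
have -> : qN = (2 * (1 - a) * (T0 - T2 - a * qa)
     - (1 - a) * (T1 - T2 - a * qa) + a * (T0 - T2 - a * qa)
     - 2 * a * (T1 - T2 - a * qa)) / (a ^+ 2 - a + 1).
  by rewrite -R2 mulrAC divff ?mul1r.
rewrite -R5; split; field.
  by rewrite ?a0 ?a1 ?a1' ?N0 ?n3.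
by rewrite ?a0 ?a1 ?a2 ?a1' ?N0 ?n3 ?n2.
Qed.

(** * The congruences *)

Theorem theorem3p3 (a : int) (p : nat) (u : nat -> int)
  (a_neq0 : a != 0) (a_neq1 : a != 1) (a_neqN1 : a != -1)
  (p_prime : prime p) (p_odd : odd p)
  (p_ndiv : ~~ (p%:Z %| 3 * a * (a - 1) * (2 - a) * (a ^+ 3 + 1))%Z)
  (u0 : u 0%N = 0) (u1 : u 1%N = 1)
  (u_rec : forall n : nat, (1 <= n)%N ->
     u (n + 1)%N = (2 - a) * u n - (a ^+ 2 - a + 1) * u (n - 1)%N) :
  ((p = 1 %[mod 3])%N ->
     rat_eqmod p
       ((u (p - 1)%N)%:Q / p%:Q)
       (- (2 / (a%:Q * (a%:Q - 1)))
            * (\sum_(1 <= k < ((p - 1) %/ 3).+1)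
                 (- a%:Q) ^+ (3 * k - 1) / (3 * k - 1)%N%:Q)
        + (a%:Q + 1) / (3 * a%:Q * (a%:Q - 1))
            * (fermatq p (a ^+ 2 - a + 1) - 2 * fermatq p (a + 1)))
     /\
     rat_eqmod p
       (\sum_(1 <= k < ((p - 1) %/ 3).+1)
          (- a%:Q) ^+ (3 * k - 1) / (3 * k - 1)%N%:Q)
       (a%:Q * (a%:Q - 1) / (a%:Q - 2)
            * (\sum_(1 <= k < ((p - 1) %/ 2).+1)
                 (- 3) ^+ (k - 1) / (2 * k - 1)%N%:Q
                   * (a%:Q / (2 - a%:Q)) ^+ (2 * k - 2))
        + a%:Q * (a%:Q - 1) / (a%:Q - 2)
            * (fermatq p a - fermatq p 2 + 1 / 2 * fermatq p 3)
        - 1 / 3 * (a%:Q + 1) * fermatq p (a + 1)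
        - (a%:Q ^+ 2 - a%:Q + 1) / (3 * (a%:Q - 2))
            * fermatq p (a ^+ 2 - a + 1)))
  /\
  ((p = 2 %[mod 3])%N ->
     rat_eqmod p
       ((u (p + 1)%N)%:Q / p%:Q)
       (2 * (a%:Q ^+ 2 - a%:Q + 1) / (a%:Q * (a%:Q - 1))
            * (\sum_(1 <= k < ((p + 1) %/ 3).+1)
                 (- a%:Q) ^+ (3 * k - 2) / (3 * k - 2)%N%:Q)
        - (a%:Q ^+ 3 + 1) / (3 * a%:Q * (a%:Q - 1))
            * (fermatq p (a ^+ 2 - a + 1) - 2 * fermatq p (a + 1)))
     /\
     rat_eqmod p
       (\sum_(1 <= k < ((p + 1) %/ 3).+1)
          (- a%:Q) ^+ (3 * k - 2) / (3 * k - 2)%N%:Q)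
       (- (a%:Q * (a%:Q - 1) / (a%:Q - 2))
            * (\sum_(1 <= k < ((p - 1) %/ 2).+1)
                 (- 3) ^+ (k - 1) / (2 * k - 1)%N%:Q
                   * (a%:Q / (2 - a%:Q)) ^+ (2 * k - 2))
        + a%:Q * (a%:Q - 1) / (a%:Q - 2)
            * (fermatq p a - fermatq p 2 + 1 / 2 * fermatq p 3)
        - 1 / 3 * (a%:Q + 1) * fermatq p (a + 1)
        - (a%:Q ^+ 2 - a%:Q + 1) / (3 * (a%:Q - 2))
            * fermatq p (a ^+ 2 - a + 1))).
Proof.
have [a0 a1 a2 aD n3] : [/\ a%:~R != 0 :> 'F_p, a%:~R - 1 != 0 :> 'F_p,
    (2 - a)%:~R != 0 :> 'F_p, a%:~R ^+ 3 + 1 != 0 :> 'F_p & 3 != 0 :> 'F_p].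
  move: p_ndiv; rewrite -Fp_eq0 // !rmorphM !rmorphD rmorphN rmorphXn /= !mulf_eq0 !negb_or.
  by case/andP=> /andP[/andP[/andP[]]] *; split.
have {aD} [a1' N0] : a%:~R + 1 != 0 :> 'F_p /\ a%:~R ^+ 2 - a%:~R + 1 != 0 :> 'F_p.
  apply/andP; rewrite -negb_or -mulf_eq0; move: aD; congr (_ != 0); ring.
have n2 : 2 != 0 :> 'F_p.
  by apply: natr_Fp_neq0 => //; move: p_odd (prime_gt1 p_prime); clear; lia.
have a2' : a%:~R - 2 != 0 :> 'F_p.
  by move: a2; rewrite rmorphB -oppr_eq0 opprB.
have aQ : (a + 1)%:~R != 0 :> 'F_p by rewrite rmorphD.
have NE : (a ^+ 2 - a + 1)%:~R = a%:~R ^+ 2 - a%:~R + 1 :> 'F_p.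
  by rewrite rmorphD rmorphB rmorphXn.
have NQ : (a ^+ 2 - a + 1)%:~R != 0 :> 'F_p by rewrite NE.
have [qa Ea fa] := fermat_quotient _ _ p_prime a0.
have [qa1 Ea1 fa1] := fermat_quotient _ _ p_prime aQ.
have [qN EN fN] := fermat_quotient _ _ p_prime NQ.
have [q2 E2 f2] := fermat_quotient _ 2 p_prime n2.
have [q3 E3 f3] := fermat_quotient _ 3 p_prime n3.
have [p_gt0 p_gt1] := (prime_gt0 p_prime, prime_gt1 p_prime).
have EpA : a ^+ p = a * (1 + p%:R * qa).
  by rewrite -Ea -exprS subn1 prednK.
have ET : (1 + a) ^+ p = 1 + a ^+ p
    + p%:R * (class_sum int p a 0 + class_sum int p a 1 + class_sum int p a 2).
  by have := exprD1_root3 _ _ a 1 p_prime (expr1n _ 3); rewrite !expr1n !mulr1.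
have Vred := reduces_odd_sum _ a p_prime p_odd a2.
have lucas_divp (n : nat) (c d : int) : c%:~R != 0 :> 'F_p -> c * u n = p%:R * d ->
    exists2 w : int, c%:~R * w%:~R = d%:~R :> 'F_p & (u n)%:Q / p%:Q = w%:Q.
  move=> c0 cu; have /dvdzP[w uE] : (p%:Z %| u n)%Z.
    have : (c * u n)%:~R == 0 :> 'F_p by rewrite cu intrM intr_Fp_p // mul0r.
    by rewrite intrM mulf_eq0 (negPf c0) Fp_eq0.
  exists w; last by rewrite uE rmorphM /= mulfK // pnatr_eq0 -lt0n.
  rewrite -rmorphM; apply: (@int_Fp_divp _ _ _ 0) => //.
  by rewrite mulr0 addr0 -cu uE natz; ring.
split=> p3.
  have XY w := eisenstein_expp1 _ _ _ w p_prime p3 EpA.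
  have Sred := reduces_class_sum2 _ a p_prime p3.
  move: (class_sum int p a 0) (class_sum int p a 1) (class_sum int p a 2) ET XY Sred.
  move=> T0 T1 T2 ET XY Sred.
  have n1 : 1 ^+ 2 - 1 * (1 * a) + (1 * a) ^+ 2 = a ^+ 2 - a + 1 by ring.
  have [E [R1 R2 R4 R5]] := eisenstein_relations _ _ _ _ _ _ _ _ _ _ _ _
    p_prime p_odd a0 (expr1n _ 2) n1 XY ET Ea Ea1 EN E2 E3.
  have [uN _] := lucas_eisenstein _ _ _ _ _ a_neq0 p_gt0 u0 u1 u_rec XY.
  have [w R3 uw] : exists2 w : int, ((a ^+ 2 - a + 1) * a)%:~R * w%:~R
      = ((a * qa + T1 - T2) - a * (T0 - T2))%:~R :> 'F_p
      & (u (p - 1)%N)%:Q / p%:Q = w%:Q.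
    apply: lucas_divp; first by rewrite intrM mulf_neq0.
    by rewrite uN; ring.
  have [||||| F1 F2] := @solve_relations1 'F_p a%:~R T0%:~R T1%:~R T2%:~R
    qa%:~R qa1%:~R qN%:~R q2%:~R q3%:~R w%:~R E%:~R (odd_sum p a)%:~R
    a0 a1 a2' a1' N0 n3 n2.
  - by apply: (eq_from_sub _ _ _ _ _ R1); ring.
  - by apply: (eq_from_sub _ _ _ _ _ R2); ring.
  - by apply: (eq_from_sub _ _ _ _ _ R4); ring.
  - by apply: (eq_from_sub _ _ _ _ _ R5); ring.
  - by apply: (eq_from_sub _ _ _ _ _ R3); ring.
  split.
    apply: reduces_eqmod p_prime _ _ F1; first by rewrite uw; exact: reduces_int.
    by rewrite fN fa1; repeat reduce_step; rewrite ?mulf_neq0.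
  apply: reduces_eqmod p_prime Sred _ F2.
  rewrite fa f2 f3 fN fa1; repeat reduce_step; by rewrite ?mulf_neq0.
  have XY w := eisenstein_expp2 _ _ _ w p_prime p3 EpA.
  have Sred := reduces_class_sum1 _ a p_prime p3.
  move: (class_sum int p a 0) (class_sum int p a 1) (class_sum int p a 2) ET XY Sred.
  move=> T0 T1 T2 ET XY Sred.
  have n1 : (1 - a) ^+ 2 - (1 - a) * ((- 1) * a) + ((- 1) * a) ^+ 2 = a ^+ 2 - a + 1 by ring.
  have [E [R1 R2 R4 R5]] := eisenstein_relations _ _ _ _ _ _ _ _ _ _ _ _
    p_prime p_odd a0 (sqrrN 1) n1 XY ET Ea Ea1 EN E2 E3.
  have [_ uN] := lucas_eisenstein _ _ _ _ _ a_neq0 p_gt0 u0 u1 u_rec XY.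
  have [w R3 uw] : exists2 w : int, a%:~R * w%:~R
      = ((T1 - T2 - a * qa) + a * (T0 - T2 - a * qa) - a * (T1 - T2 - a * qa))%:~R :> 'F_p
      & (u (p + 1)%N)%:Q / p%:Q = w%:Q.
    apply: lucas_divp => //.
    by rewrite uN; ring.
  have [||||| F1 F2] := @solve_relations2 'F_p a%:~R T0%:~R T1%:~R T2%:~R
    qa%:~R qa1%:~R qN%:~R q2%:~R q3%:~R w%:~R E%:~R (odd_sum p a)%:~R
    a0 a1 a2' a1' N0 n3 n2.
  - by apply: (eq_from_sub _ _ _ _ _ R1); ring.
  - by apply: (eq_from_sub _ _ _ _ _ R2); ring.
  - by apply: (eq_from_sub _ _ _ _ _ R4); ring.
  - by apply: (eq_from_sub _ _ _ _ _ R5); ring.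
  - by apply: (eq_from_sub _ _ _ _ _ R3); ring.
  split.
    apply: reduces_eqmod p_prime _ _ F1; first by rewrite uw; exact: reduces_int.
    by rewrite fN fa1; repeat reduce_step; rewrite ?mulf_neq0.
  apply: reduces_eqmod p_prime Sred _ F2.
  rewrite fa f2 f3 fN fa1; repeat reduce_step; by rewrite ?mulf_neq0.
Qed.
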